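(* Suppose that $p\in \mathbb{Z}[z]$ is a polynomial of degree at least 2 with a positive leading coefficient, and let $a$ and $b$ be positive integers with $\gcd(a,b)=1$. Suppose that there exist positive integers $d$ and $u$, and integers $t$ and $v$, such that the following six conditions hold: (1) $(a+b)t\equiv p(t) \pmod{d}$; (2) for every integer $k\equiv t\pmod{d}$, $a\mid p(k+d)-p(k)$; (3) for every integer $k\equiv t\pmod{d}$, letting $m=\frac{p(k+d)-p(k)}{a}$, we have $u\mid m$, and $m'=\frac{m}{u}$ satisfies $2\nmid m'$ and $\gcd(a,m')=\gcd(b,m')=\gcd(u,m')=1$; (4) $p(v)\equiv (a+b)v \pmod{u}$; (5) for every integer $k\equiv t\pmod{d}$, $p(k)\equiv (a+b)v\pmod{u}$; (6) for all integers $j\equiv v\pmod{u}$ and $k\equiv t\pmod{d}$, $b\mid p(k)-aj$. Then the equation $ax+by=p(z)$ is 2-Ramsey.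
   Context: For $k\in\mathbb{Z}^+$, an equation in the variables $x,y,z$ is called $k$-Ramsey if every colouring of the positive integers $\mathbb{Z}^+$ with $k$ colours admits infinitely many monochromatic solutions $(x,y,z)\in(\mathbb{Z}^+)^3$, i.e. solutions with $x,y,z$ all receiving the same colour. *)

(* Defs.v *)
From mathcomp Require Import all_boot all_order all_algebra.
From mathcomp Require Import classical_sets cardinality.
Set Implicit Arguments.
Unset Strict Implicit.
Unset Printing Implicit Defensive.
Import Order.TTheory GRing.Theory Num.Theory.
Local Open Scope ring_scope.
Local Open Scope classical_set_scope.

(* A colouring of the positive integers is represented by a map defined on all
   of [nat]; its value at 0 is irrelevant, since solutions are positive. *)
Definition mono_solutions (k : nat) (E : nat -> nat -> nat -> Prop)
    (c : nat -> 'I_k) : set (nat * nat * nat) :=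
  [set s | let: (x, y, z) := s in
     [/\ (0 < x)%N, (0 < y)%N & (0 < z)%N] /\
     E x y z /\ c x = c y /\ c y = c z].

Definition Ramsey (k : nat) (E : nat -> nat -> nat -> Prop) : Prop :=
  forall c : nat -> 'I_k, infinite_set (mono_solutions E c).

(* Main.v *)
(* If there are only finitely many monochromatic solutions, then the class [t mod d]
   contains arbitrarily large [k] with [k] red and [k + d] blue: otherwise it is
   eventually monochromatic and (1) gives solutions inside it. For such a [k], with
   [m = (p(k + d) - p(k)) / a], a red [x = v (mod u)] with [a x < p(k)] forces [x + m]
   to be red. Hence the red residues mod [m] become more numerous as one moves up, and
   since [m / u] is odd, the solutions of [a x + b y = p(z)] near [x = y] allow only one
   change of majority, around [p(k) / (a + b)]. So every [z] in the class of [t] mod [d]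
   or of [v] mod [u] is red when it is below [k] but not too small, and blue just above
   [k]. Solving with [z = k] and [z = k + d] then yields a change from blue to red at
   some [q] close to [p(k) / a]. By the same argument at [q], the class of [v] is blue
   around [p(k) / (2a)]; but a red element of that class just below [k] propagates there
   by steps of [m]. *)
Require Import Defs.
From mathcomp Require Import all_boot all_order all_algebra zify ring.
From mathcomp Require Import boolp.
From mathcomp Require cardinality.
Set Implicit Arguments.
Unset Strict Implicit.
Unset Printing Implicit Defensive.
Import Order.TTheory GRing.Theory Num.Theory.
Local Open Scope ring_scope.

(** * Growth of integer polynomials and of their differences *)

Lemma poly_eventually_gt0 (f : {poly int}) :
  0 < lead_coef f -> exists K : int, forall x, K <= x -> 0 < f.[x].
Proof.
elim/poly_ind: f => [|f c IH]; first by rewrite lead_coef0.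
have [-> | fn0] := eqVneq f 0.
  rewrite mul0r add0r lead_coefC => c_gt0.
  by exists 0 => x _; rewrite hornerC.
have -> : lead_coef (f * 'X + c%:P) = lead_coef f.
  rewrite lead_coefDl ?lead_coefMX //.
  by rewrite size_mulX // (leq_ltn_trans (size_polyC_leq1 _)) // ltnS size_poly_gt0.
(* A positive integer value [f.[x]] is at least 1, so [f.[x] * x >= x > |c|]. *)
move=> /IH[K fK]; exists (`|K| + `|c| + 1) => x Kx.
by rewrite hornerMXaddC; have := fK x; nia.
Qed.

Lemma poly_eventually_lt (f g : {poly int}) :
  (size f < size g)%N -> 0 < lead_coef g ->
  exists K : int, forall x, K <= x -> f.[x] < g.[x].
Proof.
move=> fg g_gt0; have [|K gtK] := @poly_eventually_gt0 (g - f).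
  by rewrite lead_coefDl // size_polyN.
by exists K => x /gtK; rewrite hornerD hornerN subr_gt0.
Qed.

Definition fwd_diff (e : int) (f : {poly int}) : {poly int} :=
  f \Po ('X + e%:P) - f.

Lemma horner_fwd_diff e f x : (fwd_diff e f).[x] = f.[x + e] - f.[x].
Proof. by rewrite hornerD hornerN horner_comp !hornerE. Qed.

Lemma size_fwd_diff_leq e (f : {poly int}) n : (size f <= n.+1)%N -> (size (fwd_diff e f) <= n)%N.
Proof.
rewrite /fwd_diff; elim/poly_ind: f n => [|f c IH] n.
  by rewrite comp_poly0 subr0 size_poly0.
have [-> | fn0] := eqVneq f 0.
  by rewrite mul0r add0r comp_polyC subrr size_poly0.
rewrite size_MXaddC (negPf fn0) /= ltnS => fn.
have -> : (f * 'X + c%:P) \Po ('X + e%:P) - (f * 'X + c%:P)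
   = (f \Po ('X + e%:P) - f) * ('X + e%:P) + e *: f.
  by rewrite comp_polyD comp_polyM comp_polyX comp_polyC -mul_polyC; ring.
case: n fn => [|n] fn; first by move: fn0; rewrite -size_poly_leq0 fn.
apply: (leq_trans (size_polyD _ _)); rewrite geq_max.
rewrite (leq_trans (size_scale_leq _ _)) // andbT.
apply: (leq_trans (size_polyMleq _ _)); rewrite size_XaddC addn2 /= ltnS.
exact: IH.
Qed.

(** In top degree the difference agrees with [e] times the derivative. In the Horner form, the
    summand [e *: fwd_diff e f] has too low a degree to contribute. *)
Lemma coef_fwd_diff e (f : {poly int}) n :
  (size f <= n.+2)%N -> (fwd_diff e f)`_n = e * f`_n.+1 *+ n.+1.
Proof.
rewrite /fwd_diff; elim/poly_ind: f n => [|f c IH] n.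
  by rewrite comp_poly0 subr0 !coef0 mulr0 mul0rn.
move=> fn; have fn' : (size f <= n.+1)%N.
  by move: fn; rewrite size_MXaddC; case: ifP => // /andP[/eqP-> _]; rewrite size_poly0.
have -> : (f * 'X + c%:P) \Po ('X + e%:P) - (f * 'X + c%:P)
   = (f \Po ('X + e%:P) - f) * 'X + e *: (fwd_diff e f) + e *: f.
  by rewrite /fwd_diff comp_polyD comp_polyM comp_polyX comp_polyC -!mul_polyC; ring.
rewrite !coefD !coefZ !coefMX coefC /= addr0.
rewrite [X in _ + _ * X + _]nth_default ?size_fwd_diff_leq // mulr0 addr0.
case: n fn fn' => [|n] fn fn' /=; first by rewrite add0r mulr1n.
by rewrite IH // [RHS]mulrS addrC.
Qed.

Lemma fwd_diff_lead e (f : {poly int}) : 0 < e -> (1 < size f)%N -> 0 < lead_coef f ->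
  size (fwd_diff e f) = (size f).-1 /\ 0 < lead_coef (fwd_diff e f).
Proof.
move=> e_gt0; case sz: (size f) => [|[|n]] // _ lf /=.
have co : 0 < (fwd_diff e f)`_n.
  rewrite coef_fwd_diff ?sz // pmulrn_lgt0 // mulr_gt0 //.
  by move: lf; rewrite lead_coefE sz.
have ss : size (fwd_diff e f) = n.+1.
  apply/anti_leq; rewrite size_fwd_diff_leq ?sz //= ltnNge.
  by apply/negP => le; move: co; rewrite nth_default.
by split=> //; rewrite lead_coefE ss.
Qed.

Lemma poly_eventually_mono (f : {poly int}) : (1 < size f)%N -> 0 < lead_coef f ->
  exists K : int, forall x y : int, K <= x -> x <= y -> f.[x] <= f.[y].
Proof.
move=> sf lf; have [_ /poly_eventually_gt0[K fK]] := @fwd_diff_lead 1 f isT sf lf.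
exists K => x y Kx xy; have -> : y = x + `|y - x|%N%:Z by lia.
elim: `|_|%N => [|n IH]; first by rewrite addr0.
apply: (le_trans IH); have /fK : K <= x + n%:Z by lia.
rewrite horner_fwd_diff; have -> : x + n.+1%:Z = x + n%:Z + 1 by lia.
by rewrite subr_gt0 => /ltW.
Qed.

(** All the size estimates used from [K] on. [S] is the half-width of a window of solutions in units
    of the increment of [p]; [E] is a distance that keeps two such windows apart; [E1] is the
    largest distance from a switch at which colours are read off; [C] dominates all numerical
    factors. *)
Record growth (p : {poly int}) (d S E E1 C K : int) : Prop := Growth {
  growth_mono : forall x y : int, K <= x -> x <= y -> p.[x] <= p.[y];
  growth_step : forall x : int, K <= x -> C <= p.[x + d] - p.[x];
  growth_below : forall x y : int, K <= y -> y <= x - E ->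
    p.[y] + 2 * S * (p.[x + d] - p.[x]) <= p.[x];
  growth_above : forall x y : int, K <= x -> x + E <= y ->
    p.[x + d] + 2 * S * (p.[x + d] - p.[x]) <= p.[y];
  growth_step_small : forall x : int, K <= x -> C * (p.[x + d] - p.[x]) <= p.[x];
  growth_step_lt : forall x : int, K <= x -> S * (p.[x + d] - p.[x]) < p.[x - E1];
  growth_shift_small : forall x : int, K <= x -> C * (p.[x + E1] - p.[x]) <= p.[x];
  growth_scaled : forall x y : int, K <= x -> K <= y -> x <= 8 * y ->
    S * (p.[x + d] - p.[x]) < p.[y];
  growth_superlinear : forall x : int, K <= x -> C * x + C <= p.[x] }.

Lemma seq_ubound (s : seq int) : exists2 K : int, 0 <= K & all (fun x => x <= K) s.
Proof.
elim: s => [|x s [K K_ge0 sK]]; first by exists 0.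
exists (K + `|x|) => /=; first by rewrite addr_ge0.
apply/andP; split; first by rewrite (le_trans (ler_norm x)) // lerDr.
by apply: sub_all sK => y yK; rewrite (le_trans yK) // lerDl.
Qed.

(** [E] is fixed before [E1] and [C], because these two are later chosen in terms of [E]. Degree at
    least 2 makes the increment [D] itself unbounded and eventually monotone. *)
Lemma growthP (p : {poly int}) (d S : int) :
  0 < d -> 0 <= S -> (2 < size p)%N -> 0 < lead_coef p ->
  exists2 E : int, 0 <= E & forall E1 C B, 0 <= E1 -> exists2 K : int, B <= K & growth p d S E E1 C K.
Proof.
move=> d_gt0 S_ge0 sp lp.
have sp1 : (1 < size p)%N by apply: ltnW.
have [D [sD lD DE]] : exists D : {poly int}, [/\ size D = (size p).-1, 0 < lead_coef D
    & forall x : int, p.[x + d] - p.[x] = D.[x]].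
  exists (fwd_diff d p); have [-> ->] := fwd_diff_lead d_gt0 sp1 lp.
  by split=> // x; rewrite horner_fwd_diff.
have sD1 : (1 < size D)%N by rewrite sD; lia.
have sDp : (size D < size p)%N by rewrite sD; lia.
(* [E] consists of [n] steps of length [d], each raising [p] by at least the first increment. The
   bound above [x] needs [2 * S + 1] steps; the one below needs [4 * S], since there [D.[x]] is only
   bounded by [2 * D.[x - E]]. *)
have [n nE] : exists n : nat, n%:Z = 4 * S + 4.
  by exists (absz (4 * S + 4)); rewrite gez0_abs // addr_ge0 ?mulr_ge0.
pose E := d * n%:Z.
have E_gt0 : 0 < E by rewrite mulr_gt0 // nE; lia.
exists E => [|E1 C B E1_ge0]; first exact: ltW.
have [K1 pmono] := poly_eventually_mono sp1 lp.
have [K2 Dmono] := poly_eventually_mono sD1 lD.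
have [K3 Dgt0] := poly_eventually_gt0 lD.
have cD_lt c (q : {poly int}) : size q = 2 -> (size (c *: (D \Po q)) < size p)%N.
  by move=> sq; apply: leq_ltn_trans (size_scale_leq _ _) _; rewrite size_comp_poly2.
have [K4 DC] : exists K, forall x : int, K <= x -> C%:P.[x] < D.[x].
  by apply: poly_eventually_lt => //; apply: leq_ltn_trans (size_polyC_leq1 _) _.
(* The difference of [D] has smaller degree than [D], so eventually [D.[x + E] < 2 * D.[x]]. *)
have [K5 D2] : exists K, forall x : int, K <= x -> (fwd_diff E D).[x] < D.[x].
  by apply: poly_eventually_lt => //; have [-> _] := fwd_diff_lead E_gt0 sD1 lD; lia.
have [K6 CDp] : exists K, forall x : int, K <= x -> (C *: D).[x] < p.[x].
  by apply: poly_eventually_lt => //; apply: leq_ltn_trans (size_scale_leq _ _) _.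
have [K7 SDp] : exists K, forall x : int, K <= x -> (S *: (D \Po ('X + E1%:P))).[x] < p.[x].
  by apply: poly_eventually_lt => //; apply: cD_lt; rewrite size_XaddC.
have [K8 CE1] : exists K, forall x : int, K <= x -> (C *: fwd_diff E1 p).[x] < p.[x].
  apply: poly_eventually_lt => //; apply: leq_ltn_trans (size_scale_leq _ _) _.
  apply: (@leq_ltn_trans (size p).-1); last by lia.
  by apply: size_fwd_diff_leq; rewrite (ltn_predK sp).
have [K9 S8] : exists K, forall x : int, K <= x -> (S *: (D \Po (8 *: 'X))).[x] < p.[x].
  by apply: poly_eventually_lt => //; apply: cD_lt; rewrite size_scale ?size_polyX.
have [K10 Clin] : exists K, forall x : int, K <= x -> (C *: 'X + C%:P).[x] < p.[x].
  apply: poly_eventually_lt => //; apply: leq_ltn_trans sp.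
  apply: leq_trans (size_polyD _ _) _; rewrite geq_max.
  rewrite (leq_trans (size_scale_leq _ _)) ?size_polyX //=.
  exact: leq_trans (size_polyC_leq1 _) _.
have [K0 K0_ge0 /=] := seq_ubound [:: K1; K2; K3; K4; K5; K6; K7; K8; K9; K10].
case/and5P => ? ? ? ? /and5P[? ? ? ? /and3P[? ? _]].
have [K [KB K_ge KE1]] : exists K : int, [/\ B <= K, K0 <= K & K0 + E1 <= K].
  by exists (K0 + E1 + `|B|); split; lia.
have D_sum (x : int) m : K <= x -> p.[x] + m%:Z * D.[x] <= p.[x + d * m%:Z].
  move=> Kx; elim: m => [|m IH]; first by rewrite mul0r mulr0 !addr0.
  have dm := mulr_ge0 (ltW d_gt0) (le0z_nat m).
  have : D.[x] <= D.[x + d * m%:Z] by apply: Dmono; lia.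
  have := DE (x + d * m%:Z).
  have -> : x + d * m.+1%:Z = x + d * m%:Z + d by lia.
  by rewrite -addn1 PoszD mulrDl mul1r; lia.
exists K => //.
split=> x.
- by move=> y Kx; apply: pmono; lia.
- by move=> Kx; rewrite DE; have := DC x; rewrite hornerC => /(_ _)/ltW; apply; lia.
- move=> y Ky yx; rewrite DE.
  have : D.[x] <= 2 * D.[x - E].
    have : K5 <= x - E by lia.
    by move/D2; rewrite horner_fwd_diff subrK; lia.
  have : p.[y] <= p.[x - E] by apply: pmono; lia.
  have : K <= x - E by lia.
  move/(D_sum _ n); rewrite -/E subrK.
  have : 0 < D.[x - E] by apply: Dgt0; lia.
  move: D.[x - E] => q q_gt0 Dsum pm /(ler_wpM2l S_ge0) Sq.
  have : n%:Z * q = 4 * (S * q) + 4 * q by rewrite nE; ring.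
  by lia.
- move=> y Kx xy; rewrite DE.
  have : p.[x + E] <= p.[y] by apply: pmono; lia.
  have := D_sum x n Kx; rewrite -/E.
  have : 0 < D.[x] by apply: Dgt0; lia.
  have := DE x; move: D.[x] => q xE q_gt0 Dsum pm.
  have Sq := mulr_ge0 S_ge0 (ltW q_gt0).
  have : n%:Z * q = 4 * (S * q) + 4 * q by rewrite nE; ring.
  by lia.
- by move=> Kx; rewrite DE -hornerZ; apply/ltW/CDp; lia.
- move=> Kx; rewrite DE; have : K7 <= x - E1 by lia.
  by move/SDp; rewrite hornerZ horner_comp !hornerE subrK.
- by move=> Kx; rewrite -horner_fwd_diff -hornerZ; apply/ltW/CE1; lia.
- move=> y Kx Ky xy; rewrite DE; have : K9 <= y by lia.
  move/S8; rewrite hornerZ horner_comp !hornerE; apply: le_lt_trans.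
  by apply: ler_wpM2l => //; apply: Dmono; lia.
move=> Kx; have : K10 <= x by lia.
by move/Clin; rewrite !hornerE => /ltW.
Qed.

(** * Counting residues, and solutions of linear equations in two unknowns *)

Lemma card_le_residues (M : nat) (f : int -> bool) (g h : 'I_M -> int) :
  (0 < M)%N ->
  (forall i j, (g i = g j %[mod M])%Z -> i = j) ->
  (forall i j, (h i = h j %[mod M])%Z -> i = j) ->
  (forall i j, (g i = h j %[mod M])%Z -> f (g i) -> f (h j)) ->
  (#|[set i | f (g i)]| <= #|[set i | f (h i)]|)%N.
Proof.
move=> M_gt0 g_inj h_inj gh.
have ltM x : (`|(x %% M)%Z| < M)%N by have := modz_ge0 x (d := M); have := ltz_pmod x (d := M); lia.
pose res x := Ordinal (ltM x).
have resP x y : res x = res y -> (x = y %[mod M])%Z.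
  by move=> /(congr1 val) /=; have := modz_ge0 x (d := M); have := modz_ge0 y (d := M); lia.
have rg_inj : injective (res \o g) by move=> i j /resP/g_inj.
have rh_inj : injective (res \o h) by move=> i j /resP/h_inj.
rewrite -(card_imset _ rg_inj) -(card_imset [set i | f (h i)] rh_inj).
apply/subset_leq_card/subsetP => _ /imsetP[i fi ->].
have /codomP[j rj] := inj_card_onto rh_inj (leqnn _) ((res \o g) i).
rewrite rj; apply: imset_f; rewrite inE (gh i j) //; first exact: resP.
by move: fi; rewrite inE.
Qed.

(** One of [g], [g'] has more than [M / 2] elements and one of [h], [h'] has fewer, strictly because
    [M] is odd. The four inequalities cover whichever pair this is. *)
Lemma odd_majority_lt (M : nat) (g g' h h' : pred 'I_M) : odd M ->
  (forall i, g i || g' i) -> (forall i, ~~ (h i && h' i)) ->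
  (#|g| <= #|h|)%N -> (#|g| <= #|h'|)%N -> (#|g'| <= #|h|)%N -> (#|g'| <= #|h'|)%N ->
  False.
Proof.
move=> M_odd cov disj.
have : (M <= #|g| + #|g'|)%N.
  rewrite -[X in (X <= _)%N](card_ord M) -(cardUI g g') (leq_trans _ (leq_addr _ _)) //.
  by apply/subset_leq_card/subsetP => i _; rewrite inE; apply: cov.
have : (#|h| + #|h'| <= M)%N.
  rewrite -[X in (_ <= X)%N](card_ord M) -(cardUI h h') [X in (_ + X)%N]eq_card0 ?addn0 ?max_card //.
  by move=> i; rewrite !inE; apply/negbTE/disj.
by lia.
Qed.

Lemma affine_residue_inj (M : nat) (c s : int) (i j : 'I_M) :
  gcdz c M = 1 -> (s + c * i%:Z = s + c * j%:Z %[mod M])%Z -> i = j.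
Proof.
move=> cM /eqP; rewrite eqz_mod_dvd.
have -> : s + c * i%:Z - (s + c * j%:Z) = c * (i%:Z - j%:Z) by ring.
rewrite Gauss_dvdzr; last by rewrite /coprimez gcdzC cM.
case/dvdzP => q qE; apply: val_inj => /=.
move: qE; have := ltn_ord i; have := ltn_ord j.
by have [q_gt0|q_lt0|->] := ltrgt0P q; [nia | nia | lia].
Qed.

Lemma bezout_window (a b w L : int) : 0 < b -> gcdz a b = 1 ->
  exists x y : int, [/\ a * x + b * y = w, L <= x & x < L + b].
Proof.
move=> b_gt0 ab; have [x0 [y0 xyE]] := Bezoutz a b; rewrite ab in xyE.
pose q := ((w * x0 - L) %/ b)%Z.
exists (w * x0 - b * q), (w * y0 + a * q).
have E := divz_eq (w * x0 - L) b; rewrite -/q in E.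
have := modz_ge0 (w * x0 - L) (d := b); have := ltz_pmod (w * x0 - L) b_gt0.
set r := (_ %% _)%Z in E *; split; [|lia..].
by transitivity (w * (x0 * a + y0 * b)); [ring | rewrite xyE mulr1].
Qed.

(* Both coordinates of all these solutions of [a x + b y = w] lie near the
   common value [w / (a + b)]; [i] ranges over a full residue system mod [M]. *)
Lemma centered_solutions (a b w M : int) : 0 < a -> 0 < b -> gcdz a b = 1 -> 0 < M ->
  exists x y : int, forall i, 0 <= i < M ->
   [/\ a * (x + b * i) + b * (y - a * i) = w,
     `|(a + b) * (x + b * i) - w| <= (a + b) ^+ 2 * M
     & `|(a + b) * (y - a * i) - w| <= (a + b) ^+ 2 * M].
Proof.
move=> a_gt0 b_gt0 ab M_gt0; pose L := (w %/ (a + b))%Z.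
have [x [y [xyE Lx xL]]] := bezout_window w L b_gt0 ab.
exists x, y => i /andP[i_ge0 i_ltM].
have ab_gt0 : 0 < a + b by lia.
have := divz_eq w (a + b); rewrite -/L.
have := modz_ge0 w (lt0r_neq0 ab_gt0); have := ltz_pmod w ab_gt0.
set r := (_ %% _)%Z => r_lt r_ge wE.
have sum : a * (x + b * i) + b * (y - a * i) = w by rewrite -xyE; ring.
set X := x + b * i in sum *; set Y := y - a * i in sum *.
have X_lo : L <= X by have := mulr_ge0 (ltW b_gt0) i_ge0; rewrite /X; lia.
have X_hi : X < L + b * M.
  have : b * (i + 1) <= b * M by rewrite ler_pM2l //; lia.
  by rewrite /X; lia.
have D_lo : - (a + b) <= (a + b) * X - w.
  by move: X_lo; rewrite -(ler_pM2l ab_gt0); lia.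
have D_hi : (a + b) * X - w <= (a + b) * (b * M).
  by move: X_hi; rewrite -(ltr_pM2l ab_gt0); lia.
have YX : b * ((a + b) * Y - w) = - (a * ((a + b) * X - w)) by rewrite -sum; ring.
have aM : a * (a + b) <= a * (a + b) * M by rewrite ler_peMr ?mulr_ge0; lia.
have bM : a + b <= b * (a + b) * M by rewrite mulrAC ler_peMl //; nia.
have aM_gt0 : 0 < a * (a + b) * M by rewrite !mulr_gt0.
have bM_gt0 : 0 < b * (a + b) * M by rewrite !mulr_gt0.
have SE : (a + b) ^+ 2 * M = a * (a + b) * M + b * (a + b) * M by ring.
split=> //; first by rewrite SE ler_norml; apply/andP; split; lia.
set A := (a + b) * Y - w in YX *; set D := (a + b) * X - w in YX D_lo D_hi.
have A_lo : - (a * (a + b) * M) <= A.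
  rewrite -(ler_pM2l b_gt0) YX mulrN lerN2.
  have -> : b * (a * (a + b) * M) = a * ((a + b) * (b * M)) by ring.
  by rewrite ler_pM2l.
have A_hi : A <= a * (a + b).
  rewrite -(ler_pM2l b_gt0) YX -mulrN.
  apply: (@le_trans _ _ (a * (a + b))); first by rewrite ler_pM2l //; lia.
  by rewrite ler_peMl ?mulr_ge0; lia.
by rewrite SE ler_norml; apply/andP; split; lia.
Qed.

(** * Changes of colour from [k] to [k + d] and their effect on shifts *)

Section Colouring.

Variables (p : {poly int}) (a b d u t v B : int) (col : int -> bool).

Let T (k : int) := exists i : int, k = t + d * i.
Let good (z : int) := exists w : int, p.[z] = (a + b) * v + u * w.
Let Delta (k : int) := p.[k + d] - p.[k].
Let S := (a + b) ^+ 2.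

Hypotheses (a_gt0 : 0 < a) (b_gt0 : 0 < b) (d_gt0 : 0 < d) (u_gt0 : 0 < u).
Hypotheses (ab : gcdz a b = 1) (B_gt0 : 0 < B).
Hypothesis no_sol : forall x y z : int, 0 < x -> 0 < y -> B <= z ->
  a * x + b * y = p.[z] -> col x = col y -> col y = col z -> False.
Hypothesis good_T : forall k, T k -> good k.
Hypothesis T_split : forall k j, T k -> exists y, p.[k] = a * (v + u * j) + b * y.
Hypothesis T_step : forall k, T k -> exists M : int,
  [/\ Delta k = a * (u * M), ~~ (2 %| M)%Z, gcdz a M = 1 & gcdz b M = 1].

(** Keeping the colour [s] as a parameter lets the same lemmas serve the red-to-blue changes
    ([true]) and the blue-to-red ones ([false]). *)
Definition switch (s : bool) (k : int) :=
  [/\ T k, B <= k, col k = s, col (k + d) = ~~ s & 0 < Delta k].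

(* Through [k], the partner [y] of [x] has the other colour; through [k + d], the
   partner of [y] is [x + m]. *)
Lemma switch_shift s k m j : switch s k -> Delta k = a * m ->
  0 < v + u * j -> a * (v + u * j) < p.[k] -> col (v + u * j) = s ->
  col (v + u * j + m) = s.
Proof.
case=> Tk Bk ks kds Dk_gt0 Dk x_gt0 xk xs.
have [y yE] := T_split j Tk.
have y_gt0 : 0 < y by rewrite -(pmulr_rgt0 _ b_gt0); lia.
have m_gt0 : 0 < m by rewrite -(pmulr_rgt0 _ a_gt0) -Dk.
have ys : col y = ~~ s.
  case: (col y =P ~~ s) => // ys; exfalso.
  have {}ys : col y = s by move: ys; case: (col y) (s) => [] [].
  by apply: (no_sol x_gt0 y_gt0 Bk); [rewrite yE | rewrite xs | rewrite ys].
case: (col (v + u * j + m) =P s) => // xms; exfalso.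
have {}xms : col (v + u * j + m) = ~~ s by move: xms; case: (col _) (s) => [] [].
refine (@no_sol (v + u * j + m) y (k + d) _ _ _ _ _ _); rewrite ?xms ?ys ?kds //; try lia.
by move: Dk; rewrite /Delta; lia.
Qed.

Lemma switch_shift_iter s k M j (n : nat) : switch s k -> Delta k = a * (u * M) ->
  0 < v + u * j -> a * (v + u * (j + M * n%:Z)) <= p.[k] -> col (v + u * j) = s ->
  col (v + u * (j + M * n%:Z)) = s.
Proof.
move=> sw Dk x_gt0 + xs.
have uM_gt0 : 0 < u * M by rewrite -(pmulr_rgt0 _ a_gt0) -Dk; case: sw.
elim: n => [|n IH]; first by move=> _; rewrite mulr0 addr0.
have -> : v + u * (j + M * n.+1%:Z) = v + u * (j + M * n%:Z) + u * M by rewrite -addn1 PoszD; ring.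
have auM_gt0 : 0 < a * (u * M) by rewrite mulr_gt0.
rewrite mulrDr => le_k; apply: (switch_shift sw Dk).
- by have := mulr_ge0 (ltW uM_gt0) (le0z_nat n); lia.
- by lia.
by apply: IH; lia.
Qed.

(* In a window of [M] solutions of [a x + b y = p(z)] around [x = y], each of the
   two coordinates runs through all residues mod the odd number [M]. By
   [switch_shift] the residues of colour [s] can only become more numerous upwards;
   the solutions for [z'] put them in the majority, those for [z] in the minority. *)
Lemma switch_windows s k z z' : switch s k ->
  good z -> B <= z -> col z = s ->
  good z' -> B <= z' -> col z' = ~~ s ->
  S * Delta k < p.[z'] -> p.[z'] + 2 * S * Delta k <= p.[z] ->
  a * (p.[z] + S * Delta k) <= (a + b) * p.[k] -> False.
Proof.
move=> sw [w wE] Bz zs [w' wE'] Bz' zs' z'_lo zz' z_hi.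
have [Tk Bk ks kds Dk_gt0] := sw; have [M [Dk M_odd aM bM]] := T_step Tk.
have uM_gt0 : 0 < u * M by rewrite -(pmulr_rgt0 _ a_gt0) -Dk.
have M_gt0 : 0 < M by rewrite -(pmulr_rgt0 _ u_gt0).
have [N ME] : exists N : nat, M = N%:Z by exists `|M|%N; lia.
have N_gt0 : (0 < N)%N by lia.
have N_odd : odd N by move: M_odd; rewrite ME; lia.
rewrite ME in Dk aM bM M_gt0 uM_gt0.
(* For unknowns [v + u * j] and [v + u * j'], [wE] turns [a x + b y = p.[z]] into [a j + b j' = w].
   The windows are therefore taken in the indices, modulo [N], where one shift by [u * N] is a shift
   by [Delta k / a]. *)
have [x [y xyP]] := centered_solutions w a_gt0 b_gt0 ab M_gt0.
have [x' [y' xyP']] := centered_solutions w' a_gt0 b_gt0 ab M_gt0.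
rewrite -/S in xyP xyP'.
have iP (i : 'I_N) : 0 <= i%:Z < N%:Z by have := ltn_ord i; lia.
pose X (i : 'I_N) := x + b * i%:Z; pose Y (i : 'I_N) := y - a * i%:Z.
pose X' (i : 'I_N) := x' + b * i%:Z; pose Y' (i : 'I_N) := y' - a * i%:Z.
pose f j := col (v + u * j) == s.
have SD : S * Delta k = a * (u * (S * N%:Z)) by rewrite Dk; ring.
have SD_ge : u * (S * N%:Z) <= S * Delta k.
  have S_ge0 : 0 <= S by exact: sqr_ge0.
  by rewrite SD ler_peMl // mulr_ge0 ?(ltW u_gt0) // mulr_ge0.
(* Back in the unknowns, the half-width is [u * S * N], which is at most [S * Delta k] as
   [a >= 1]. *)
have near j W : `|(a + b) * j - W| <= S * N%:Z ->
    (a + b) * v + u * W - S * Delta k <= (a + b) * (v + u * j)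
      <= (a + b) * v + u * W + S * Delta k.
  rewrite ler_norml => /andP[]; rewrite -(ler_pM2l u_gt0) => lo.
  by rewrite -(ler_pM2l u_gt0) => hi; apply/andP; split; lia.
have nearz j : `|(a + b) * j - w| <= S * N%:Z ->
    p.[z] - S * Delta k <= (a + b) * (v + u * j) <= p.[z] + S * Delta k.
  by move/near; rewrite wE.
have nearz' j : `|(a + b) * j - w'| <= S * N%:Z ->
    p.[z'] - S * Delta k <= (a + b) * (v + u * j) <= p.[z'] + S * Delta k.
  by move/near; rewrite wE'.
have ab_gt0 : 0 < a + b by lia.
(* The gap [zz'] places the window of [z'] below that of [z], so [h] is reached from [g] by upward
   steps of [N]; [z_hi] keeps the whole climb below [p.[k] / a]. *)
have mono g h : `|(a + b) * g - w'| <= S * N%:Z -> `|(a + b) * h - w| <= S * N%:Z ->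
    (g = h %[mod N])%Z -> f g -> f h.
  move=> /nearz'/andP[g_lo g_hi] /nearz/andP[h_lo h_hi] /eqP.
  rewrite eqz_mod_dvd => /dvdzP[q qE] /eqP gs; apply/eqP.
  have g_gt0 : 0 < v + u * g by rewrite -(pmulr_rgt0 _ ab_gt0); lia.
  have gh : v + u * g <= v + u * h by rewrite -(ler_pM2l ab_gt0); lia.
  have q_le0 : q <= 0.
    have : u * (q * N%:Z) <= 0 by rewrite -qE; lia.
    by rewrite pmulr_rle0 // pmulr_lle0.
  have -> : h = g + N%:Z * `|q|%N%:Z by lia.
  apply: (switch_shift_iter sw Dk g_gt0) => //.
  have -> : g + N%:Z * `|q|%N%:Z = h by lia.
  rewrite -(ler_pM2l ab_gt0); apply: le_trans z_hi.
  by rewrite mulrCA ler_pM2l.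
have inj c e (i j : 'I_N) : gcdz c N = 1 ->
    (e + c * i%:Z = e + c * j%:Z %[mod N])%Z -> i = j.
  exact: affine_residue_inj.
have injN c e (i j : 'I_N) : gcdz c N = 1 ->
    (e - c * i%:Z = e - c * j%:Z %[mod N])%Z -> i = j.
  by rewrite -!mulNr => cN; apply: affine_residue_inj; rewrite gcdNz.
have count g h : (forall i, `|(a + b) * g i - w'| <= S * N%:Z) ->
    (forall i, `|(a + b) * h i - w| <= S * N%:Z) ->
    (forall i j : 'I_N, (g i = g j %[mod N])%Z -> i = j) ->
    (forall i j : 'I_N, (h i = h j %[mod N])%Z -> i = j) ->
    (#|[set i | f (g i)]| <= #|[set i | f (h i)]|)%N.
  by move=> gP hP gI hI; apply: card_le_residues => // i j; apply: mono.
have XP i : `|(a + b) * X i - w| <= S * N%:Z by have [] := xyP _ (iP i).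
have YP i : `|(a + b) * Y i - w| <= S * N%:Z by have [] := xyP _ (iP i).
have XP' i : `|(a + b) * X' i - w'| <= S * N%:Z by have [] := xyP' _ (iP i).
have YP' i : `|(a + b) * Y' i - w'| <= S * N%:Z by have [] := xyP' _ (iP i).
have SD_ge0 : 0 <= S * Delta k by rewrite mulr_ge0 ?sqr_ge0 ?(ltW Dk_gt0).
have zz'_le : p.[z'] <= p.[z] by apply: le_trans zz'; rewrite lerDl -mulrA mulr_ge0.
have pos g : (a + b) * (v + u * g) >= p.[z'] - S * Delta k -> 0 < v + u * g.
  by move=> g_lo; rewrite -(pmulr_rgt0 _ ab_gt0); lia.
have XI i j := @inj b x i j bM; have XI' i j := @inj b x' i j bM.
have YI i j := @injN a y i j aM; have YI' i j := @injN a y' i j aM.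
refine (@odd_majority_lt N (mem [set i | f (X' i)]) (mem [set i | f (Y' i)])
  (mem [set i | f (X i)]) (mem [set i | f (Y i)]) N_odd _ _ (count _ _ XP' XP XI' XI)
  (count _ _ XP' YP XI' YI) (count _ _ YP' XP YI' XI) (count _ _ YP' YP YI' YI)).
- move=> i; rewrite !inE -[_ || _]negbK negb_or; apply/negP => /andP[Xs Ys].
  have [sum _ _] := xyP' _ (iP i).
  have {}Xs : col (v + u * X' i) = ~~ s by move: Xs; rewrite /f; case: col (s) => [] [].
  have {}Ys : col (v + u * Y' i) = ~~ s by move: Ys; rewrite /f; case: col (s) => [] [].
  refine (no_sol _ _ Bz' _ (etrans Xs (esym Ys)) (etrans Ys (esym zs'))).
  + by apply: pos; case/andP: (nearz' _ (XP' i)).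
  + by apply: pos; case/andP: (nearz' _ (YP' i)).
  by rewrite wE' -sum /X' /Y'; ring.
move=> i; rewrite !inE; apply/negP => /andP[/eqP Xs /eqP Ys].
have [sum _ _] := xyP _ (iP i).
refine (no_sol _ _ Bz _ (etrans Xs (esym Ys)) (etrans Ys (esym zs))).
+ by apply: pos; case/andP: (nearz _ (XP i)) => + _; apply: le_trans; rewrite lerD2r.
+ by apply: pos; case/andP: (nearz _ (YP i)) => + _; apply: le_trans; rewrite lerD2r.
by rewrite wE -sum /X /Y; ring.
Qed.

(** * Solutions inside the class of [t], and colours around a large switch *)

Hypothesis good_v : forall j, good (v + u * j).
Hypothesis T_sum : forall k, T k -> exists w, p.[k] = (a + b) * t + d * w.

(** By [T_sum] the equation reduces to [a x + b y = w]. [bezout_window] is used with [a] and [b]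
    exchanged, so that the coordinate to be localised is [y]. *)
Lemma T_solution k L : T k -> exists x y, [/\ a * (t + d * x) + b * (t + d * y) = p.[k],
  L <= y & y < L + a].
Proof.
case/T_sum => w ->; have [] := @bezout_window b a w L a_gt0; first by rewrite gcdzC.
by move=> y [x [<- yL Ly]]; exists x, y; split=> //; ring.
Qed.

Lemma switch_between s i j : 0 < t + d * i -> B <= t + d * i -> (forall k, t + d * i <= k -> 0 < Delta k) ->
  i <= j -> col (t + d * i) = s -> col (t + d * j) = ~~ s ->
  exists2 k, t + d * i <= k <= t + d * j & switch s k.
Proof.
move=> i_gt0 Bi D_gt0 ij si.
have -> : j = i + `|j - i|%N%:Z by lia.
elim: `|_|%N => [|n IH]; first by rewrite addr0 si => /esym; case: (s).
have le_n : t + d * i <= t + d * (i + n%:Z).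
  by rewrite lerD2l ler_pM2l // lerDl le0z_nat.
have step : t + d * (i + n.+1%:Z) = t + d * (i + n%:Z) + d by rewrite -addn1 PoszD; ring.
case: (col (t + d * (i + n%:Z)) =P s) => [ns nS | /eqP ns _].
  exists (t + d * (i + n%:Z)); first by rewrite le_n step lerDl ltW.
  split=> //; [by exists (i + n%:Z) | exact: le_trans le_n | by rewrite -step | exact: D_gt0].
have [|k /andP[ik kn] sk] := IH; first by move: ns; case: col (s) => [] [].
by exists k => //; rewrite ik (le_trans kn) // step lerDl ltW.
Qed.

Variables E E1 C K : int.
(** Between the distances [E] and [E1] from [k] there is room for the [a] consecutive members of the
    class of [t] among which [T_solution] picks [y], and for a member of the class of [v] modulo
    [u]. *)
Hypotheses (E_ge0 : 0 <= E) (E1E : E1 = d * (E + a) + u) (BK : B <= K).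
Hypothesis C_big : 2 * a * S + 8 * a + 2 * b + 2 * a * E + 2 * b * E1 + 1 <= C.
Hypothesis gr : growth p d S E E1 C K.

Lemma scale_le c x : 0 <= x -> c <= C -> c * x <= C * x.
Proof. by move=> x_ge0 cC; apply: ler_wpM2r. Qed.

Let S_gt0 : 0 < S. Proof. by rewrite exprn_gt0 // addr_gt0. Qed.
Let K_gt0 : 0 < K. Proof. exact: lt_le_trans BK. Qed.
Let dE : E <= d * E. Proof. by rewrite ler_peMl // -gtz0_ge1. Qed.
Let E1_gt : d * E + d * a + u = E1. Proof. by rewrite E1E; ring. Qed.
Let aS_ge0 : 0 <= a * S. Proof. exact: mulr_ge0 (ltW a_gt0) (ltW S_gt0). Qed.
Let aE_ge0 : 0 <= a * E. Proof. exact: mulr_ge0 (ltW a_gt0) E_ge0. Qed.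
Let E1_gt0 : 0 < E1. Proof. by rewrite E1E ltr_wpDl // mulr_ge0 ?(ltW d_gt0) // addr_ge0 // ltW. Qed.
Let bE1_gt0 : 0 < b * E1. Proof. by rewrite mulr_gt0. Qed.

Let C_ge : [/\ 2 * (a * S) <= C, 8 * a <= C, 2 * b <= C, 2 * (a * E) <= C
  & 2 * (b * E1) + 1 <= C].
Proof.
move: C_big aS_ge0 aE_ge0 bE1_gt0; rewrite -!mulrA.
by move: (a * S) (a * E) (b * E1) => x y z Cb *; split; lia.
Qed.

Lemma growth_Delta_gt0 k : K <= k -> 0 < Delta k.
Proof. by move/(growth_step gr); apply: lt_le_trans; case: C_ge; lia. Qed.

Lemma growth_Delta_bounds k : K <= k ->
  [/\ 2 * (a * S * Delta k) <= p.[k], 8 * (a * Delta k) <= p.[k] & Delta k <= p.[k] ].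
Proof.
move=> Kk; have D_gt0 := growth_Delta_gt0 Kk.
have D_le := growth_step_small gr Kk; rewrite -/(Delta k) in D_le.
have := @scale_le (2 * (a * S)) (Delta k) (ltW D_gt0).
have := @scale_le (8 * a) (Delta k) (ltW D_gt0).
have := @scale_le 1 (Delta k) (ltW D_gt0).
have [C1 C2 C3 _ _] := C_ge.
move=> h1 h2 h3; split; apply: le_trans D_le.
- by rewrite mulrA; apply: h3.
- by rewrite mulrA; apply: h2.
by rewrite -{1}[Delta k]mul1r; apply: h1; lia.
Qed.

(** Otherwise [switch_windows] applies with [k] as the upper point and [z] as the lower one;
    [a * S * Delta k] is small against [p.[k] <= b * p.[k]]. *)
Lemma switch_colour_below s k z : switch s k -> K + E1 <= k -> good z ->
  k - E1 <= z -> z <= k - E -> col z = s.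
Proof.
move=> sw Kk gz kz zk; have [Tk Bk ks _ D_gt0] := sw.
have Kk' : K <= k by lia.
have [D1 D2 D3] := growth_Delta_bounds Kk'.
apply/eqP; apply: contraT => zs; exfalso.
have {}zs : col z = ~~ s by move: zs; case: col (s) => [] [].
apply: (switch_windows sw (good_T Tk) Bk ks gz _ zs).
- by lia.
- apply: lt_le_trans (growth_step_lt gr Kk') _; apply: (growth_mono gr); lia.
- by apply: (growth_below gr); lia.
have : p.[k] <= b * p.[k] by rewrite ler_peMl -?gtz0_ge1 //; lia.
by lia.
Qed.

(** If [z] had colour [s], it would be the upper point and [k + d] the lower one. As [z <= k + E1],
    [p.[z]] exceeds [p.[k]] by so little that the upper window stays below [p.[k] / a]. *)
Lemma switch_colour_above s k z : switch s k -> K <= k -> good z ->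
  k + E <= z -> z <= k + E1 -> col z = ~~ s.
Proof.
move=> sw Kk gz kz zk; have [Tk Bk ks kds D_gt0] := sw.
have [D1 D2 D3] := growth_Delta_bounds Kk.
case: (col z =P s) => [zs | /eqP]; last by case: col (s) => [] [].
have Tkd : T (k + d) by case: Tk => i ->; exists (i + 1); ring.
have aS_ge : S * Delta k <= a * S * Delta k.
  by rewrite -mulrA ler_peMl -?gtz0_ge1 // mulr_ge0 ?ltW.
exfalso; apply: (switch_windows sw gz _ zs (good_T Tkd) _ kds).
- by lia.
- by lia.
- have : p.[k + d] = p.[k] + Delta k by rewrite /Delta; ring.
  by lia.
- by apply: (growth_above gr).
have pz : p.[z] <= p.[k + E1] by apply: (growth_mono gr); lia.
have := growth_shift_small gr Kk.
have pE1 : p.[k] <= p.[k + E1] by apply: (growth_mono gr); lia.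
have : 2 * a * (p.[k + E1] - p.[k]) <= C * (p.[k + E1] - p.[k]).
  by apply: scale_le; [lia | case: C_ge; lia].
have : p.[k] <= b * p.[k] by rewrite ler_peMl -?gtz0_ge1 //; lia.
have : a * p.[z] <= a * p.[k + E1] by rewrite ler_pM2l.
by lia.
Qed.

Lemma growth_superlinear_bounds k : K <= k ->
  [/\ 8 * (a * k) <= p.[k], 2 * (b * k) + 2 * (a * E) <= p.[k] & 0 < a * k].
Proof.
move=> Kk; have k_gt0 : 0 < k by lia.
have [C1 C2 C3 C4 _] := C_ge.
have Ck := growth_superlinear gr Kk.
have h1 := scale_le (ltW k_gt0) C2; have h2 := scale_le (ltW k_gt0) C3.
have ak := mulr_gt0 a_gt0 k_gt0; rewrite -!mulrA in h1 h2.
by split=> //; move: aE_ge0 Ck h1 h2 C2 C4; clear; lia.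
Qed.

(** A solution for [k] with [Y1] just below [k], hence red, has a blue [X1]; a solution for [k + d]
    with [Y2] just above [k], hence blue, has a red [X2]. The switch lies between [X1] and [X2]. *)
Lemma opposite_switch_above k : switch true k -> K + E1 <= k ->
  exists q, [/\ switch false q, k <= q, p.[k] <= a * q + b * k & a * q <= p.[k + d]].
Proof.
move=> sw Kk; have [Tk Bk ks kds D_gt0] := sw.
have Kk' : K <= k by lia.
have [i ki] := Tk; have Tkd : T (k + d) by exists (i + 1); rewrite ki; ring.
have [p1 p2 ak_gt0] := growth_superlinear_bounds Kk'.
have k_gt0 : 0 < k := lt_le_trans K_gt0 Kk'.
have bk_gt0 := mulr_gt0 b_gt0 k_gt0.
have da_gt0 := mulr_gt0 d_gt0 a_gt0.
(* The two lower bounds put [Y1] in [[k - E1, k - E]] and [Y2] in [[k + E, k + E1]], where the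
   colours are known. *)
have [x1 [y1 [sol1 y1_lo y1_hi]]] := T_solution (i - E - a) Tk.
have [x2 [y2 [sol2 y2_lo y2_hi]]] := T_solution (i + E) Tkd.
set X1 := t + d * x1 in sol1; set X2 := t + d * x2 in sol2.
set Y1 := t + d * y1 in sol1; set Y2 := t + d * y2 in sol2.
have Y1_lo : k - E1 <= Y1.
  have : d * (i - E - a) <= d * y1 by rewrite ler_pM2l.
  by move: u_gt0; rewrite ki /Y1 -E1_gt; clear; lia.
have Y1_hi : Y1 <= k - E.
  have : d * y1 <= d * (i - E) by rewrite ler_pM2l //; move: y1_hi; clear; lia.
  by move: dE; rewrite ki /Y1; clear; lia.
have Y2_lo : k + E <= Y2.
  have : d * (i + E) <= d * y2 by rewrite ler_pM2l.
  by move: dE; rewrite ki /Y2; clear; lia.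
have Y2_hi : Y2 <= k + E1.
  have : d * y2 <= d * (i + E + a) by rewrite ler_pM2l // ltW.
  by move: u_gt0; rewrite ki /Y2 -E1_gt; clear; lia.
have Y1s : col Y1 = true.
  by apply: switch_colour_below sw Kk _ Y1_lo Y1_hi; apply: good_T; exists y1.
have Y2s : col Y2 = false.
  by apply: switch_colour_above sw Kk' _ Y2_lo Y2_hi; apply: good_T; exists y2.
have bY1 : b * Y1 <= b * k.
  by rewrite ler_pM2l //; move: Y1_hi E_ge0; clear; lia.
have kX1 : k <= X1.
  by rewrite -(ler_pM2l a_gt0); move: sol1 p1 p2 ak_gt0 aE_ge0 bY1; clear; lia.
(* Passing from [k] to [k + d] raises the right-hand side by [Delta k], which exceeds the at most
   [2 * (b * E1)] absorbed by [Y]; hence [X1 < X2]. *)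
have bY12 : b * Y2 <= b * Y1 + 2 * (b * E1).
  have -> : b * Y1 + 2 * (b * E1) = b * (Y1 + 2 * E1) by ring.
  by rewrite ler_pM2l //; move: Y1_lo Y2_hi; clear; lia.
have DC : 2 * (b * E1) < Delta k.
  have [_ _ _ _ C1] := C_ge; have := growth_step gr Kk'.
  by apply: lt_le_trans; move: C1; clear; lia.
have X12 : X1 < X2.
  by rewrite -(ltr_pM2l a_gt0); move: sol1 sol2 DC bY12; rewrite /Delta; clear; lia.
have Y1_gt0 : 0 < Y1 by move: Y1_lo Kk K_gt0; clear; lia.
have Y2_gt0 : 0 < Y2 by move: Y2_lo E_ge0 k_gt0; clear; lia.
have X1_gt0 := lt_le_trans k_gt0 kX1.
have Bkd : B <= k + d by move: Bk d_gt0; clear; lia.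
have X1s : col X1 = false.
  apply/negbTE/negP => X1s; apply: (no_sol X1_gt0 Y1_gt0 Bk sol1); by rewrite ?X1s ?Y1s ?ks.
have X2s : col X2 = true.
  apply: contraT => /negbTE X2s; exfalso.
  by apply: (no_sol (lt_trans X1_gt0 X12) Y2_gt0 Bkd sol2); rewrite ?X2s ?Y2s ?kds.
have x12 : x1 <= x2 by move: X12; rewrite ltrD2l ltr_pM2l // => /ltW.
have D_pos l : X1 <= l -> 0 < Delta l.
  by move=> X1l; apply: growth_Delta_gt0; apply: le_trans X1l; apply: le_trans kX1.
have [q /andP[q1 q2] sq] :=
  switch_between X1_gt0 (le_trans Bk kX1) D_pos x12 X1s X2s.
exists q; split=> //; first exact: le_trans q1.
  have : a * X1 <= a * q by rewrite ler_pM2l.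
  by move: sol1 bY1; clear; lia.
have : a * q <= a * X2 by rewrite ler_pM2l.
have : 0 < b * Y2 by rewrite mulr_gt0.
by move: sol2; clear; lia.
Qed.

Lemma no_large_switch k : switch true k -> K + E1 <= k -> False.
Proof.
move=> sw Kk; have [q [sq kq q_lo q_hi]] := opposite_switch_above sw Kk.
have [Tk Bk ks kds D_gt0] := sw; have [Tq Bq qs qds Dq_gt0] := sq.
have Kk' : K <= k by move: Kk E1_gt0; clear; lia.
have Kq := le_trans Kk' kq.
have [p1 p2 ak_gt0] := growth_superlinear_bounds Kk'.
have [D1 D2 D3] := growth_Delta_bounds Kk'; have [Dq1 _ Dq3] := growth_Delta_bounds Kq.
have [M [Dk _ _ _]] := T_step Tk.
have m_gt0 : 0 < u * M by rewrite -(pmulr_rgt0 _ a_gt0) -Dk.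
(* [v + u * j] is the largest member of the class of [v] that is at most [k - E]. *)
pose j := ((k - E - v) %/ u)%Z.
have jE := divz_eq (k - E - v) u; rewrite -/j in jE.
have r_ge := modz_ge0 (k - E - v) (lt0r_neq0 u_gt0).
have r_lt := ltz_pmod (k - E - v) u_gt0.
have y_hi : v + u * j <= k - E by move: jE r_ge; rewrite mulrC; move: (_ %% _)%Z; clear; lia.
have y_lo : k - E1 <= v + u * j.
  have := mulr_ge0 (ltW d_gt0) (ltW a_gt0).
  by move: jE r_lt dE; rewrite -E1_gt mulrC; move: (_ %% _)%Z; clear; lia.
have y_gt0 : 0 < v + u * j by move: y_lo Kk K_gt0; clear; lia.
have ys : col (v + u * j) = true by apply: switch_colour_below sw Kk _ y_lo y_hi.
have ay : a * (v + u * j) <= a * k.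
  by rewrite ler_pM2l //; move: y_hi E_ge0; clear; lia.
(* [n] shifts bring [a * z] just below [p.[k] / 2], with an error less than [Delta k]. Thus [z] is
   about half of [q]: below it by more than [E], yet large enough for [q <= 8 * z]. *)
have [n [n_lo n_hi]] : exists n : nat, 2 * (a * (v + u * j)) + 2 * Delta k * n%:Z <= p.[k]
    /\ p.[k] < 2 * (a * (v + u * j)) + 2 * Delta k * n%:Z + 2 * Delta k.
  have D2_gt0 : 0 < 2 * Delta k by rewrite mulr_gt0.
  pose W := p.[k] - 2 * (a * (v + u * j)).
  have W_ge0 : 0 <= W by rewrite /W; move: ay p1 ak_gt0; clear; lia.
  have WE := divz_eq W (2 * Delta k).
  have R_ge := modz_ge0 W (lt0r_neq0 D2_gt0); have R_lt := ltz_pmod W D2_gt0.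
  exists `|(W %/ (2 * Delta k))%Z|%N; rewrite gez0_abs ?divz_ge0 //.
  by move: WE R_ge R_lt; rewrite {2 3}/W mulrC; move: (_ %/ _)%Z (_ %% _)%Z; clear; lia.
pose z := v + u * (j + M * n%:Z).
have az : a * z = a * (v + u * j) + Delta k * n%:Z by rewrite Dk /z; ring.
have pk_gt0 : 0 < p.[k] by move: p1 ak_gt0; clear; lia.
have azk : a * z <= p.[k].
  by rewrite az; move: n_lo pk_gt0; clear; lia.
have zs : col z = true by apply: (switch_shift_iter sw Dk).
have aD : Delta k <= a * Delta k by rewrite ler_peMl -?gtz0_ge1 // ltW.
have az_lo : 3 * p.[k] <= 8 * (a * z).
  by rewrite az; move: n_hi D2 aD pk_gt0; clear; lia.
have kz : k <= z.
  by rewrite -(ler_pM2l a_gt0); move: az_lo p1 pk_gt0; clear; lia.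
have qz : q <= 8 * z.
  rewrite -(ler_pM2l a_gt0); have : p.[k + d] = p.[k] + Delta k by rewrite /Delta; ring.
  by move: az_lo q_hi D3 pk_gt0; clear; lia.
have zq : z <= q - E.
  rewrite -(ler_pM2l a_gt0); move: n_lo q_lo p2; rewrite az.
  by clear; lia.
have Kz := le_trans Kk' kz.
(* The red [z] is the lower point and the blue [q] the upper one, for the blue-to-red switch at
   [q]. *)
apply: (switch_windows sq (good_T Tq) Bq qs (good_v _) _ zs).
- exact: le_trans BK Kz.
- by apply: (growth_scaled gr).
- by apply: (growth_below gr).
have : p.[q] <= b * p.[q] by rewrite ler_peMl -?gtz0_ge1 // (le_trans (ltW Dq_gt0)).
by move: Dq1 Dq3 Dq_gt0; clear; lia.
Qed.

(** Without such a switch, red passes from [k] to [k + d], so the class of [t] is eventually of one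
    colour, and [T_solution] yields a monochromatic solution in it. *)
Lemma large_switch n : exists2 k, n <= k & switch true k.
Proof.
apply: contrapT => no_switch; pose N := `|n| + K + `|t|.
have dge i : 0 <= i -> i <= d * i by move=> i_ge0; rewrite ler_peMl -?gtz0_ge1.
have T_ge i : N <= i -> [/\ n <= t + d * i, K <= t + d * i & B <= t + d * i].
  move=> Ni; have := dge i; move: Ni BK K_gt0; rewrite /N; clear => Ni BK K_gt0.
  have i_ge0 : 0 <= i by lia.
  by move/(_ i_ge0); split; lia.
have stay i : N <= i -> col (t + d * i) = true -> col (t + d * (i + 1)) = true.
  move=> Ni ci; have [ni Ki Bi] := T_ge i Ni.
  apply: contraT => /negbTE cSi; exfalso; apply: no_switch; exists (t + d * i) => //.
  split=> //; first by exists i.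
    by have -> : t + d * i + d = t + d * (i + 1) by ring.
  exact: growth_Delta_gt0.
have [s [i0 [Ni0 i0s]]] : exists s i0, N <= i0 /\ forall i, i0 <= i -> col (t + d * i) = s.
  case: (EM (exists2 i, N <= i & col (t + d * i) = true)) => [[i Ni ci]|none].
    exists true, i; split=> // l il; have -> : l = i + `|l - i|%N%:Z by lia.
    elim: `|_|%N => [|m IH]; first by rewrite addr0.
    by rewrite -addn1 PoszD addrA stay // (le_trans Ni) // lerDl le0z_nat.
  exists false, N; split=> // i Ni; apply/negbTE/negP => ci.
  by apply: none; exists i.
(* Since [y < i0 + a], a value of [p] that is at least [R] forces [x >= i0]. The choice of [i] makes
   [t + d * i], and a fortiori its image under [p], at least [R]. *)
pose R := a * (t + d * i0) + b * (t + d * (i0 + a)).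
pose i := i0 + `|R|; have i0i : i0 <= i by rewrite lerDl.
have [_ Kk Bk] := T_ge i (le_trans Ni0 i0i); have k_gt0 := lt_le_trans B_gt0 Bk.
have [_ Ki0 Bi0] := T_ge i0 Ni0.
have Tk : T (t + d * i) by exists i.
have [x [y [sol y_lo y_hi]]] := T_solution i0 Tk.
have Rp : R <= p.[t + d * i].
  have [p1 _ ak_gt0] := growth_superlinear_bounds Kk.
  have RD : R <= d * `|R| := le_trans (ler_norm R) (dge _ (normr_ge0 _)).
  have Dk : d * `|R| <= t + d * i.
    by rewrite mulrDr addrA lerDr ltW // (lt_le_trans K_gt0).
  have ka : t + d * i <= a * (t + d * i) by rewrite ler_peMl -?gtz0_ge1 // ltW.
  apply: le_trans (le_trans RD (le_trans Dk (le_trans ka _))) p1.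
  by rewrite ler_peMl // ltW.
have Y_lo : t + d * i0 <= t + d * y by rewrite lerD2l ler_pM2l.
have Y_hi : b * (t + d * y) <= b * (t + d * (i0 + a)).
  by rewrite ler_pM2l // lerD2l ler_pM2l // ltW.
have X_lo : t + d * i0 <= t + d * x.
  by rewrite -(ler_pM2l a_gt0); move: Rp Y_hi; rewrite -sol /R; clear; lia.
have x_lo : i0 <= x by move: X_lo; rewrite lerD2l ler_pM2l.
have i0_gt0 := lt_le_trans B_gt0 Bi0.
by apply: (no_sol (lt_le_trans i0_gt0 X_lo) (lt_le_trans i0_gt0 Y_lo) Bk sol);
  rewrite !i0s.
Qed.

Lemma switches_absurd : False.
Proof. by have [k Kk sk] := large_switch (K + E1); apply: no_large_switch sk Kk. Qed.

End Colouring.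

(** * Congruences for polynomial values, and the theorem *)

Lemma eqz_modP (x y n : int) : (x = y %[mod n])%Z -> exists w, x = y + n * w.
Proof.
move/eqP; rewrite eqz_mod_dvd => /dvdzP[w xy]; exists w.
by rewrite mulrC -xy addrC subrK.
Qed.

Lemma horner_congr (p : {poly int}) (x n i : int) :
  exists w, p.[x + n * i] = p.[x] + n * w.
Proof.
have /factor_theorem[q qE] : root (p - p.[x]%:P) x.
  by rewrite rootE hornerD hornerN hornerC subrr.
exists (q.[x + n * i] * i).
have := congr1 (horner^~ (x + n * i)) qE; rewrite !hornerE /=.
by move/eqP; rewrite subr_eq => /eqP ->; ring.
Qed.

Theorem theorem1p3 (p : {poly int}) (a b : int)
  (hdeg : (2 <= (size p).-1)%N) (hlead : 0 < lead_coef p)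
  (ha : 0 < a) (hb : 0 < b) (hab : gcdz a b = 1)
  (hex : exists d u t v : int,
    0 < d /\ 0 < u /\
    ((a + b) * t = p.[t] %[mod d])%Z /\
    (forall k : int, (k = t %[mod d])%Z ->
       (a %| p.[k + d] - p.[k])%Z) /\
    (forall k : int, (k = t %[mod d])%Z ->
       let m := ((p.[k + d] - p.[k]) %/ a)%Z in
       (u %| m)%Z /\
       let m' := (m %/ u)%Z in
       [/\ ~~ (2 %| m')%Z, gcdz a m' = 1, gcdz b m' = 1 & gcdz u m' = 1]) /\
    (p.[v] = (a + b) * v %[mod u])%Z /\
    (forall k : int, (k = t %[mod d])%Z ->
       (p.[k] = (a + b) * v %[mod u])%Z) /\
    (forall j k : int, (j = v %[mod u])%Z -> (k = t %[mod d])%Z ->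
       (b %| p.[k] - a * j)%Z)) :
  Ramsey 2 (fun x y z : nat => a * x%:Z + b * y%:Z = p.[z%:Z]).
Proof.
have [d [u [t [v [d_gt0 [u_gt0 [h1 [h2 [h3 [h4 [h5 h6]]]]]]]]]]] := hex.
rewrite /Ramsey => c /cardinality.finite_seqP[s sE].
(* If the monochromatic solutions are finite in number, none has [z >= B]. *)
have [B B_gt0 sB] : exists2 B : int, 0 < B & forall e, e \in s -> e.2%:Z < B.
  exists (\max_(e <- s) e.2).+1%:Z => // e es.
  by rewrite ltz_nat ltnS; apply: leq_bigmax_seq.
(* Red is colour 0. The absolute value only serves to make [col] total on the integers. *)
pose col (x : int) : bool := c `|x|%N == ord0.
have colE x y : col x = col y -> c `|x|%N = c `|y|%N.
  rewrite /col; case: (c `|x|%N) (c `|y|%N) => [[|[|i]] ?] // [[|[|j]] ?] // _;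
  exact/val_inj.
pose E1 E := d * (E + a) + u; pose S := (a + b) ^+ 2.
have [] := @growthP p d S d_gt0 (sqr_ge0 _) _ hlead; first by lia.
move=> E E_ge0.
have E1_ge0 : 0 <= E1 E.
  exact: addr_ge0 (mulr_ge0 (ltW d_gt0) (addr_ge0 E_ge0 (ltW ha))) (ltW u_gt0).
pose C := 2 * a * S + 8 * a + 2 * b + 2 * a * E + 2 * b * E1 E + 1.
case/(_ _ C B E1_ge0) => K BK gr.
have T_mod k : (exists i, k = t + d * i) -> (k = t %[mod d])%Z.
  by case=> i ->; rewrite mulrC addrC modzMDl.
apply: (@switches_absurd p a b d u t v B col ha hb d_gt0 u_gt0 hab B_gt0
  _ _ _ _ _ _ E (E1 E) C K E_ge0 erefl BK _ gr) => //.
- move=> x y z x_gt0 y_gt0 Bz xyz xy yz.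
  have : (`|x|%N, `|y|%N, `|z|%N) \in s.
    have : mono_solutions (fun x y z : nat => a * x%:Z + b * y%:Z = p.[z%:Z]) c
        (`|x|%N, `|y|%N, `|z|%N).
      split; first by split; lia.
      split; last by split; apply: colE.
      by rewrite !gez0_abs ?ltW // (lt_le_trans B_gt0).
    by rewrite sE.
  by move/sB; rewrite /= gez0_abs; lia.
- by move=> k /T_mod/h5/eqz_modP[w ->]; exists w.
- move=> k j /T_mod Tk; have /h6/(_ Tk) : (v + u * j = v %[mod u])%Z.
    by rewrite mulrC addrC modzMDl.
  by case/dvdzP=> y yE; exists y; lia.
- move=> k /T_mod Tk; have [uD [odd2 am bm um]] := h3 k Tk.
  exists (((p.[k + d] - p.[k]) %/ a)%Z %/ u)%Z; split=> //.
  by rewrite [u * _]mulrC divzK // mulrC divzK // h2.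
- move=> j; have [w1 e1] := horner_congr p v u j.
  by have [w2 e2] := eqz_modP h4; exists (w2 + w1); rewrite e1 e2; ring.
move=> k [i ->]; have [w1 e1] := horner_congr p t d i.
by have [w2 e2] := eqz_modP (esym h1); exists (w2 + w1); rewrite e1 e2; ring.
Qed.
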